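(* Let $p$ be a prime. For every $x\in\mathbb{C}_p$ the Volkenborn integral $$\operatorname{Log}\Gamma_p(x):=\int_{\mathbb{Z}_p}(x+t)\big(\log_p(x+t)-1\big)\chi(x+t)\,dt$$ exists, and the resulting function $\operatorname{Log}\Gamma_p:\mathbb{C}_p\to\mathbb{C}_p$ is locally analytic on $\mathbb{C}_p$.
   Context: $\mathbb{C}_p$ is the completion of the algebraic closure of $\mathbb{Q}_p$, with absolute value $|\cdot|_p$. $\log_p:\mathbb{C}_p^*\to\mathbb{C}_p$ is the Iwasawa $p$-adic logarithm: the homomorphism given by the usual power series of the logarithm on $\{|x-1|_p<1\}$ and normalized by $\log_p(p)=0$. The Volkenborn integral of $g:\mathbb{Z}_p\to\mathbb{C}_p$ is $\int_{\mathbb{Z}_p}g(t)\,dt:=\lim_{N\to\infty}p^{-N}\sum_{j=0}^{p^N-1}g(j)$ when the limit exists. $\chi:\mathbb{C}_p\to\{0,1\}$ is the characteristic function of $\{x\in\mathbb{C}_p:|x|_p\ge1\}$; the integrand is $0$ whenever $|x+t|_p<1$. A function $f:A\to\mathbb{C}_p$, $A\subset\mathbb{C}_p$, is locally analytic on $A$ if for each $a\in A$ there is an open ball $D\subset A$ of positive radius containing $a$ such that $f$ is represented on $D$ by a power series $\sum_{n\ge0}a_n(x-y)^n$ ($y$ a center of $D$, $a_n\in\mathbb{C}_p$) convergent for all $x\in D$. *)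

(* Defs.v *)
From HB Require Import structures.
From mathcomp Require Import all_boot all_order all_algebra.
From mathcomp Require Import all_classical all_reals all_analysis.

Set Implicit Arguments.
Unset Strict Implicit.
Unset Printing Implicit Defensive.

Import Order.TTheory GRing.Theory Num.Theory.
Local Open Scope classical_set_scope.
Local Open Scope ring_scope.

(* A field with a non-archimedean absolute value. The library's normedZmodType
   cannot be used for this: it imposes |x *+ n| = |x| *+ n. *)
HB.mixin Record Field_isUltrametric (R : realType) K & GRing.Field K := {
  vabs : K -> R;
  vabs_ge0 : forall x, 0 <= vabs x;
  vabs_eq0 : forall x, (vabs x == 0) = (x == 0);
  vabsM : {morph vabs : x y / x * y >-> x * y};
  vabsD : forall x y, vabs (x + y) <= Num.max (vabs x) (vabs y)
}.

#[short(type="ultrametricFieldType")]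
HB.structure Definition UltrametricField (R : realType) :=
  { K of GRing.Field K & Field_isUltrametric R K }.

Section UltrametricField.
Context {R : realType}.

Section Theory.
Variable K : ultrametricFieldType R.
Implicit Types x y z : K.

Lemma vabs0 : vabs (0 : K) = 0.
Proof. by apply/eqP; rewrite vabs_eq0. Qed.

Lemma vabs1 : vabs (1 : K) = 1.
Proof.
have n0 : vabs (1 : K) != 0 by rewrite vabs_eq0 oner_eq0.
by apply: (mulfI n0); rewrite -vabsM !mulr1.
Qed.

Lemma vabsN x : vabs (- x) = vabs x.
Proof.
rewrite -mulN1r vabsM; suff -> : vabs (-1 : K) = 1 by rewrite mul1r.
by apply/eqP; rewrite -sqrp_eq1 ?vabs_ge0// expr2 -vabsM mulrNN mulr1 vabs1.
Qed.

Lemma vabs_nat (n : nat) : vabs (n%:R : K) <= 1.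
Proof.
elim: n => [|n IHn]; first by rewrite vabs0 ler01.
by rewrite -natr1 (le_trans (vabsD _ _))// vabs1 ge_max IHn lexx.
Qed.

Definition vdist x y : R := vabs (x - y).

Lemma vdistxx x : vdist x x = 0.
Proof. by rewrite /vdist subrr vabs0. Qed.

Lemma vdist_positivity x y : vdist x y = 0 -> x = y.
Proof. by move/eqP; rewrite vabs_eq0 subr_eq0 => /eqP. Qed.

Lemma vdist_sym x y : vdist x y = vdist y x.
Proof. by rewrite /vdist -opprB vabsN. Qed.

Lemma vdist_triangle y x z : vdist x z <= vdist x y + vdist y z.
Proof.
rewrite /vdist -(subrKA y) (le_trans (vabsD _ _))//.
by rewrite ge_max lerDl lerDr !vabs_ge0.
Qed.

HB.instance Definition _ := isMetric.Build R (UltrametricField.sort K)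
  vdistxx vdist_positivity vdist_sym vdist_triangle.
HB.instance Definition _ := isPointed.Build (UltrametricField.sort K) 0.

Definition valuation_ring := {t : K | vabs t <= 1}.

Definition valuation_ring_nat (n : nat) : valuation_ring :=
  exist _ n%:R (vabs_nat n).

Definition is_complete :=
  forall F : set_system K, ProperFilter F -> cauchy F -> cvg F.

Definition locally_analytic (A : set K) (f : K -> K) :=
  forall a, A a -> exists (y : K) (r : R) (c : nat -> K),
    [/\ 0 < r, ball y r `<=` A, ball y r a &
        forall x, ball y r x ->
          series (fun n => c n * (x - y) ^+ n) @ \oo --> f x].

(* The value log 0 is left arbitrary. *)
Record is_Iwasawa_log (p : nat) (log : K -> K) : Prop := IsIwasawaLog {
  Iwasawa_logM :
    forall x y, x != 0 -> y != 0 -> log (x * y) = log x + log y;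
  Iwasawa_log_series :
    forall x, vabs (x - 1) < 1 ->
      series (fun n => (-1) ^+ n * (x - 1) ^+ n.+1 / n.+1%:R) @ \oo --> log x;
  Iwasawa_log_p : log p%:R = 0
}.

End Theory.

Definition padic_abs (p : nat) (q : rat) : R :=
  if q == 0 then 0
  else p%:R ^ ((logn p `|denq q|%N)%:Z - (logn p `|numq q|%N)%:Z).

End UltrametricField.

(* A tower of isometric embeddings rat -> Qp -> Qpbar -> Cp in which Qp is a
   completion of rat for the p-adic absolute value, Qpbar is an algebraic
   closure of Qp, and Cp is a completion of Qpbar. These conditions determine
   the tower up to isometric isomorphism. *)
Record padic_tower (R : realType) (p : nat) := PadicTower {
  Qp : ultrametricFieldType R;
  Qpbar : ultrametricFieldType R;
  Cp : ultrametricFieldType R;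
  Qp_Qpbar : {rmorphism Qp -> Qpbar};
  Qpbar_Cp : {rmorphism Qpbar -> Cp};
  vabs_rat : forall q : rat, vabs (ratr q : Qp) = padic_abs p q;
  complete_Qp : is_complete Qp;
  dense_rat : dense (range (fun q : rat => ratr q : Qp));
  vabs_Qpbar : forall x : Qp, vabs (Qp_Qpbar x) = vabs x;
  Qpbar_algebraic : forall x : Qpbar, algebraicOver Qp_Qpbar x;
  Qpbar_closed : GRing.closed_field_axiom Qpbar;
  vabs_Cp : forall x : Qpbar, vabs (Qpbar_Cp x) = vabs x;
  complete_Cp : is_complete Cp;
  dense_Qpbar : dense (range Qpbar_Cp)
}.

Section LogGamma.
Context {R : realType} {p : nat} (T : padic_tower R p).

Local Notation Zp := (valuation_ring (Qp T)).

Definition Zp_Cp (t : Zp) : Cp T := Qpbar_Cp T (Qp_Qpbar T (sval t)).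

Definition Volkenborn_sum (g : Zp -> Cp T) (N : nat) : Cp T :=
  ((p ^ N)%:R)^-1 * \sum_(j < p ^ N) g (valuation_ring_nat (Qp T) j).

Definition Volkenborn_integrable (g : Zp -> Cp T) :=
  cvg (Volkenborn_sum g @ \oo).

Definition Volkenborn_integral (g : Zp -> Cp T) : Cp T :=
  lim (Volkenborn_sum g @ \oo).

Definition chi : Cp T -> Cp T := \1_[set x : Cp T | 1 <= vabs x].

Definition LogGamma_integrand (log : Cp T -> Cp T) (x : Cp T) (t : Zp) : Cp T :=
  (x + Zp_Cp t) * (log (x + Zp_Cp t) - 1) * chi (x + Zp_Cp t).

Definition LogGamma (log : Cp T -> Cp T) (x : Cp T) : Cp T :=
  Volkenborn_integral (LogGamma_integrand log x).

End LogGamma.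

(* Main.v *)
Require Import Defs.
From mathcomp Require Import all_boot all_order all_algebra.
From mathcomp Require Import all_classical all_reals all_analysis.
From mathcomp Require Import ring lra.

(* Put F(y) = y (log y - 1). For |y| >= 1 > |z| the functional equation of log
   gives F(y + z) = sum_m a_m(y) z^m with |a_m(y)| <= 4^m for m >= 2, and the
   condition |x + z + k| >= 1 does not depend on z. Hence the Volkenborn sums at
   x + z are power series in z whose m-th coefficient is the Volkenborn sum of
   k |-> chi(x + k) a_m(x + k). The p^(N+1)-term and p^N-term Volkenborn sums
   of a function that is second-order Taylor approximable along increments
   divisible by p^3 differ by O(p^-N), because the first-order terms add up to
   a multiple of the sum of the derivative, which is itself O(p^-N). Here this
   holds with constant O(4^m), so for |z| < 1/8 the coefficients may be replaced
   by their limits, with an error O(p^-N) uniform in m. The radius 1/8, and the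
   exponent 3 that ensures |p^3| <= 1/8, make 4^m |h|^m at most 2^-m. *)

Set Implicit Arguments.
Unset Strict Implicit.
Unset Printing Implicit Defensive.

Import Order.TTheory GRing.Theory Num.Theory.
Local Open Scope classical_set_scope.
Local Open Scope ring_scope.

(** * Limits and series in ultrametric fields *)

Section Ultrametric.
Context {R : realType} {K : ultrametricFieldType R}.
Implicit Types (u v : nat -> K) (l : K) (x y : K).

Lemma vabs_cvgP u l :
  u @ \oo --> l <-> forall e, 0 < e -> \forall n \near \oo, vabs (l - u n) < e.
Proof.
split=> [/cvg_ballP ul e /ul|ul].
  by apply: filterS => n; rewrite ballEmdist.
apply/cvg_ballP => e /ul.
by apply: filterS => n; rewrite ballEmdist.
Qed.

Lemma vabs_le_add x y (C : R) : vabs x <= C -> vabs y <= C -> vabs (x + y) <= C.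
Proof. by move=> xC yC; rewrite (le_trans (vabsD _ _))// ge_max xC yC. Qed.

Lemma vabs_lt_add x y (C : R) : vabs x < C -> vabs y < C -> vabs (x + y) < C.
Proof. by move=> xC yC; rewrite (le_lt_trans (vabsD _ _))// gt_max xC yC. Qed.

Lemma vabs_le_sub x y (C : R) : vabs x <= C -> vabs y <= C -> vabs (x - y) <= C.
Proof. by move=> xC yC; rewrite vabs_le_add// vabsN. Qed.

Lemma vabs_le_sum I (r : seq I) (P : pred I) (F : I -> K) (C : R) : 0 <= C ->
  (forall i, P i -> vabs (F i) <= C) -> vabs (\sum_(i <- r | P i) F i) <= C.
Proof.
move=> C0 FC; elim/big_ind: _ => //; first by rewrite vabs0.
by move=> *; exact: vabs_le_add.
Qed.

Lemma vabsX x n : vabs (x ^+ n) = vabs x ^+ n.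
Proof. by elim: n => [|n IH]; rewrite ?expr0 ?vabs1// !exprS vabsM IH. Qed.

Lemma vabsV x : vabs x^-1 = (vabs x)^-1.
Proof.
have [->|x0] := eqVneq x 0; first by rewrite invr0 vabs0 invr0.
have vx0 : vabs x != 0 by rewrite vabs_eq0.
by apply: (mulfI vx0); rewrite -vabsM !mulfV// vabs1.
Qed.

(** Otherwise [x = (x + y) - y] would have absolute value smaller than [vabs x]. *)
Lemma vabs_addl_gt x y : vabs y < vabs x -> vabs (x + y) = vabs x.
Proof.
move=> yx; apply/eqP; rewrite eq_le; apply/andP; split.
  by rewrite vabs_le_add// ltW.
rewrite leNgt; apply/negP => xyx.
have : vabs (x + y - y) < vabs x by rewrite vabs_lt_add ?vabsN.
by rewrite addrK ltxx.
Qed.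

Lemma vabs_cvgD u v l m : u @ \oo --> l -> v @ \oo --> m ->
  (fun n => u n + v n) @ \oo --> l + m.
Proof.
move=> /vabs_cvgP ul /vabs_cvgP vm; apply/vabs_cvgP => e e0.
apply: filterS2 (ul e e0) (vm e e0) => n ule vme.
by rewrite opprD addrACA vabs_lt_add.
Qed.

Lemma vabs_cvgMl x u l : u @ \oo --> l -> (fun n => x * u n) @ \oo --> x * l.
Proof.
have [->|x0] := eqVneq x 0.
  by move=> _; under eq_fun do rewrite mul0r; rewrite mul0r; exact: cvg_cst.
have vx0 : 0 < vabs x by rewrite lt_def vabs_eq0 x0 vabs_ge0.
move=> /vabs_cvgP ul; apply/vabs_cvgP => e e0.
apply: filterS (ul (e / vabs x) (divr_gt0 e0 vx0)) => n.
by rewrite -mulrBr vabsM ltr_pdivlMr// mulrC.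
Qed.

Lemma vabs_cvg_sum I (r : seq I) (F : I -> nat -> K) (L : I -> K) :
  (forall i, F i @ \oo --> L i) ->
  (fun n => \sum_(i <- r) F i n) @ \oo --> \sum_(i <- r) L i.
Proof.
move=> FL; elim: r => [|i r IH].
  by under eq_fun do rewrite big_nil; rewrite big_nil; exact: cvg_cst.
by under eq_fun do rewrite big_cons; rewrite big_cons; exact: vabs_cvgD.
Qed.

(** If [vabs (l - x)] exceeded [C], then [l - x] would be the sum of [l - u n] and [u n - x], both
    strictly smaller for large [n]. *)
Lemma vabs_cvg_le u l x (C : R) N : u @ \oo --> l ->
  (forall n, (N <= n)%N -> vabs (u n - x) <= C) -> vabs (l - x) <= C.
Proof.
move=> /vabs_cvgP ul uC; rewrite leNgt; apply/negP => lC.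
have l0 : 0 < vabs (l - x).
  by rewrite (le_lt_trans _ lC)// (le_trans _ (uC N (leqnn _)))// vabs_ge0.
near \oo => n.
have : vabs (l - u n + (u n - x)) < vabs (l - x).
  apply: vabs_lt_add; first by near: n; exact: ul.
  by rewrite (le_lt_trans _ lC)// uC//; near: n; exact: nbhs_infty_ge.
by rewrite subrKA ltxx.
Unshelve. all: by end_near. Qed.

Lemma near_geometric_half_lt (B e : R) : 0 < e ->
  \forall n \near \oo, B * 2 ^- n < e.
Proof.
move=> e0; have [B0|B0] := leP B 0.
  near=> n; rewrite (le_lt_trans _ e0)// mulr_le0_ge0// invr_ge0 exprn_ge0//.
near=> n; rewrite ltr_pdivrMr ?exprn_gt0// mulrC -ltr_pdivrMr//.
(* [upper_nthrootP] is the Archimedean bound: [x < 2 ^+ n] once [Num.bound x <= n]. *)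
near: n; exists (Num.bound (B / e)) => // n /= nB.
exact: upper_nthrootP.
Unshelve. all: by end_near. Qed.

Lemma geometric_half_anti (B : R) m n : 0 <= B -> (m <= n)%N ->
  B * 2 ^- n <= B * 2 ^- m.
Proof.
move=> B0 mn; rewrite ler_wpM2l// lef_pV2 ?posrE ?exprn_gt0//.
by rewrite ler_eXn2l ?ltr1n.
Qed.

(** In an ultrametric field telescoping costs no constant: the bound on the first step dominates. *)
Lemma vabs_telescope_le u (B : R) N n m : 0 <= B ->
  (forall n, (N <= n)%N -> vabs (u n.+1 - u n) <= B * 2 ^- n) ->
  (N <= n <= m)%N -> vabs (u m - u n) <= B * 2 ^- n.
Proof.
move=> B0 uB /andP[Nn nm]; rewrite -(subnKC nm).
elim: (m - n)%N => [|k IH].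
  by rewrite addn0 subrr vabs0 mulr_ge0// invr_ge0 exprn_ge0.
rewrite addnS -(subrKA (u (n + k)%N)) vabs_le_add//.
have Nnk : (N <= n + k)%N by rewrite (leq_trans Nn)// leq_addr.
rewrite (le_trans (uB _ Nnk))//.
by rewrite geometric_half_anti// leq_addr.
Qed.

Section Complete.
Hypothesis complete_K : is_complete K.

(** Telescoping makes the sequence Cauchy and passes its rate on to the limit. The explicit rate
    later gives errors uniform in the coefficient index. *)
Lemma geometric_half_cvg u (B : R) N : 0 <= B ->
  (forall n, (N <= n)%N -> vabs (u n.+1 - u n) <= B * 2 ^- n) ->
  exists l, u @ \oo --> l /\
    forall n, (N <= n)%N -> vabs (l - u n) <= B * 2 ^- n.
Proof.
move=> B0 uB.
have /cvg_ex[l ul] : cvg (u @ \oo).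
  apply: complete_K; apply: cauchy_exP => e e0.
  have [M _ Me] := near_geometric_half_lt B e0.
  exists (u (maxn M N)); exists (maxn M N) => // n /= MNn.
  rewrite ballEmdist/= metric_sym (le_lt_trans _ (Me (maxn M N) _))//=.
    by apply: vabs_telescope_le uB _; rewrite // MNn leq_maxr.
  exact: leq_maxl.
exists l; split=> // n Nn.
apply: (vabs_cvg_le (N := n) ul) => m nm.
by apply: vabs_telescope_le uB _; rewrite // Nn.
Qed.

Lemma geometric_half_series_cvg u (B : R) :
  (forall n, vabs (u n) <= B * 2 ^- n) ->
  exists l, series u @ \oo --> l /\ vabs l <= B.
Proof.
move=> uB.
have B0 : 0 <= B.
  rewrite (le_trans (vabs_ge0 (u 0%N)))// (le_trans (uB _))//.
  by rewrite expr0 invr1 mulr1.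
have [n _|l [ul lB]] := @geometric_half_cvg (series u) B 0 B0.
  by rewrite /series/= big_nat_recr//= addrAC subrr add0r.
exists l; split=> //.
have := lB 0%N (leqnn _).
by rewrite /series/= big_geq// subr0 expr0 invr1 mulr1.
Qed.

End Complete.

Lemma vabs_series_le u l (C : R) N : 0 <= C -> series u @ \oo --> l ->
  (forall n, (N <= n)%N -> vabs (u n) <= C) ->
  vabs (l - \sum_(0 <= i < N) u i) <= C.
Proof.
move=> C0 ul uC; apply: (vabs_cvg_le (N := N) ul) => n Nn.
rewrite /series/= (big_cat_nat (leq0n N) Nn)/= addrAC subrr add0r big_nat_cond.
by apply: vabs_le_sum => // i /andP[/andP[Ni _] _]; exact: uC.
Qed.

End Ultrametric.

(** * Means over residues *)

Section VolkenbornMean.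
Context {R : realType} {K : ultrametricFieldType R} (p : nat).
Hypothesis p_prime : prime p.
Hypothesis vabs_p : vabs (p%:R : K) = p%:R^-1.
Implicit Types (f g : nat -> K) (C : R).

(** Volkenborn sums see only the values at natural numbers, so integrands are encoded as
    sequences. *)
Definition mean f N : K := ((p ^ N)%:R)^-1 * \sum_(0 <= j < p ^ N) f j.

Let p_gt0 : 0 < p%:R :> R. Proof. by rewrite ltr0n prime_gt0. Qed.
Let p_ge1 : 1 <= p%:R :> R. Proof. by rewrite ler1n prime_gt0. Qed.
Let pX_gt0 n : 0 < p%:R ^+ n :> R. Proof. by rewrite exprn_gt0. Qed.

Let pX_ge0 n : 0 <= p%:R ^+ n :> R. Proof. exact: ltW. Qed.
Let p_ge0 : 0 <= p%:R :> R. Proof. exact: ltW. Qed.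

Lemma vabs_expn N : vabs ((p ^ N)%:R : K) = p%:R ^- N.
Proof. by rewrite natrX vabsX vabs_p exprVn. Qed.

Lemma vabs_expnV N : vabs ((p ^ N)%:R^-1 : K) = p%:R ^+ N.
Proof. by rewrite vabsV vabs_expn invrK. Qed.

Lemma expn_neq0 N : (p ^ N)%:R != 0 :> K.
Proof. by rewrite -vabs_eq0 vabs_expn invr_eq0 gt_eqF. Qed.

Lemma vabs_muln_expn i N : vabs ((i * p ^ N)%:R : K) <= p%:R ^- N.
Proof. by rewrite natrM vabsM vabs_expn ler_piMl ?vabs_nat// invr_ge0. Qed.

(** Write the indices below [p ^ N.+1] as [k + i * p ^ N], and repeat the shorter sum [p] times to
    reach the common denominator. *)
Lemma mean_sub f N : mean f N.+1 - mean f N =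
  (p ^ N.+1)%:R^-1 *
    \sum_(0 <= i < p) \sum_(0 <= k < p ^ N) (f (k + i * p ^ N)%N - f k).
Proof.
have -> : mean f N.+1 = (p ^ N.+1)%:R^-1 *
    \sum_(0 <= i < p) \sum_(i * p ^ N <= j < i.+1 * p ^ N) f j.
  by rewrite -big_nat_mul -expnS.
rewrite /mean.
have -> : ((p ^ N)%:R : K)^-1 = (p ^ N.+1)%:R^-1 * p%:R.
  have pN0 := expn_neq0 N.
  have p0 : p%:R != 0 :> K by have := expn_neq0 1; rewrite expn1.
  by rewrite expnS natrM; field; rewrite p0 pN0.
rewrite -mulrA -mulrBr; congr (_ * _).
have -> : p%:R * \sum_(0 <= j < p ^ N) f j =
    \sum_(0 <= i < p) \sum_(0 <= j < p ^ N) f j.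
  by rewrite sumr_const_nat subn0 mulr_natl.
rewrite -sumrB.
apply: eq_bigr => i _; rewrite sumrB; congr (_ - _).
by rewrite mulSn -{1}[(i * p ^ N)%N]add0n big_addn addnK.
Qed.

Lemma mean_const_le f C N : 0 <= C -> (forall k, vabs (f k) <= C) ->
  vabs (mean f N) <= p%:R ^+ N * C.
Proof.
move=> C0 fC; rewrite /mean vabsM vabs_expnV ler_wpM2l//.
exact: vabs_le_sum.
Qed.

Section FirstOrder.
Context (g : nat -> K) (C : R) (n0 : nat).
Hypothesis C0 : 0 <= C.
Hypothesis g_lip : forall k h, (p ^ n0 %| h)%N ->
  vabs (g (k + h)%N - g k) <= C * vabs (h%:R : K).
Hypothesis g_bounded : forall k, vabs (g k) <= C.

Lemma mean_lipschitz_step N : (n0 <= N)%N ->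
  vabs (mean g N.+1 - mean g N) <= p%:R * C.
Proof.
move=> nN; rewrite mean_sub vabsM vabs_expnV exprS -mulrA.
rewrite ler_wpM2l// mulrC -ler_pdivlMr//.
apply: vabs_le_sum => [|i _]; first by rewrite divr_ge0.
apply: vabs_le_sum => [|k _]; first by rewrite divr_ge0.
rewrite (le_trans (g_lip _ _))//; first by rewrite dvdn_mull// dvdn_exp2l.
by rewrite ler_wpM2l// vabs_muln_expn.
Qed.

(** The trivial bound [p ^ n0 * C] at [N = n0] survives: every later step is at most [p * C], and
    only the maximum counts. *)
Lemma mean_lipschitz_bounded N : (n0 <= N)%N ->
  vabs (mean g N) <= p%:R ^+ n0.+1 * C.
Proof.
move=> /subnKC <-; elim: (N - n0)%N => [|k IH].
  rewrite addn0 (le_trans (mean_const_le _ C0 _))//.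
  by rewrite ler_wpM2r// ler_weXn2l.
rewrite addnS -[mean g _.+1](subrK (mean g (n0 + k))) vabs_le_add//.
rewrite (le_trans (mean_lipschitz_step _)) ?leq_addr// ler_wpM2r//.
by rewrite -[leLHS]expr1 ler_weXn2l.
Qed.

(* The sums of [f] telescope to its second-order Taylor remainder, up to the
   sum of the derivative [g], which is [p ^ N] times a bounded mean. *)
Lemma mean_taylor_step f N :
  (forall k h, (p ^ n0 %| h)%N ->
    vabs (f (k + h)%N - f k - g k * h%:R) <= C * vabs (h%:R : K) ^+ 2) ->
  (n0 <= N)%N ->
  vabs (mean f N.+1 - mean f N) <= p%:R ^+ n0.+2 * C * p%:R ^- N.
Proof.
move=> f_taylor nN; rewrite mean_sub.
pose h i := (i * p ^ N)%N.
under eq_bigr => i _ do under eq_bigr => k _ do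
  rewrite -[f _ - f _](subrK (g k * (h i)%:R)).
under eq_bigr do rewrite big_split/=.
rewrite big_split/= mulrDr vabs_le_add//.
  rewrite vabsM vabs_expnV mulrC -ler_pdivlMr//.
  (* The remainders have size [C * p ^ (-2N)]; the prefactor, of size [p ^ N.+1], leaves
     [p * C * p ^ (-N)]. *)
  have CN : C * (p%:R ^- N) ^+ 2 <=
      p%:R ^+ n0.+2 * C * p%:R ^- N / p%:R ^+ N.+1.
    rewrite [leRHS](_ : _ = p%:R ^+ n0.+1 * (C * (p%:R ^- N) ^+ 2)).
      by rewrite ler_peMl ?mulr_ge0 ?exprn_ge0 ?invr_ge0 ?exprn_ege1.
    have := pX_gt0 N; rewrite 2!exprS [p%:R ^+ N.+1]exprS.
    move: (p%:R ^+ N) (p%:R ^+ n0) p_gt0 => a b p0 a0.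
    by field; rewrite !gt_eqF.
  have b0 : 0 <= p%:R ^+ n0.+2 * C * p%:R ^- N / p%:R ^+ N.+1.
    by rewrite divr_ge0// mulr_ge0 ?invr_ge0 ?pX_ge0// mulr_ge0.
  apply: vabs_le_sum => // i _; apply: vabs_le_sum => // k _.
  rewrite (le_trans (f_taylor _ _ _))//.
    by rewrite dvdn_mull// dvdn_exp2l.
  rewrite (le_trans _ CN)// ler_wpM2l// lerXn2r ?nnegrE ?vabs_ge0//.
  exact: vabs_muln_expn.
(* One factor [p ^ N] comes from [h i], another from rewriting the sum of [g] as [p ^ N * mean g N].
   Against the prefactor this leaves [p * p ^ (-N)] times the bound [p ^ n0.+1 * C] on the mean,
   hence the exponent [n0.+2]. *)
have -> : \sum_(0 <= i < p) \sum_(0 <= k < p ^ N) g k * (h i)%:R =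
    (\sum_(0 <= i < p) i)%:R * ((p ^ N)%:R * (p ^ N)%:R) * mean g N.
  rewrite natr_sum !mulr_suml; apply: eq_bigr => i _.
  rewrite -mulr_suml /mean /h natrM.
  have := expn_neq0 N; move: ((p ^ N)%:R : K) (\sum_(0 <= k < _) _) => q s q0.
  by field.
move: (mean g N) (mean_lipschitz_bounded nN) => M M_le.
rewrite !vabsM vabs_expnV vabs_expn.
rewrite [leLHS](_ : _ = p%:R ^- N * (p%:R * (vabs ((\sum_(0 <= i < p) i)%:R : K)
   * vabs M))); last first.
  have := pX_gt0 N; rewrite exprS; move: (p%:R ^+ N) => a a0.
  by field; rewrite gt_eqF.
rewrite mulrC ler_wpM2r ?invr_ge0 ?pX_ge0// exprS -mulrA ler_wpM2l//.
by rewrite (le_trans _ M_le)// ler_piMl ?vabs_ge0// vabs_nat.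
Qed.

End FirstOrder.

(** Every [k] differs by a multiple of [p ^ n0] from one of finitely many residues. *)
Lemma bounded_of_lipschitz g C n0 :
  (forall k h, (p ^ n0 %| h)%N -> vabs (g (k + h)%N - g k) <= C) ->
  exists B, forall k, vabs (g k) <= B.
Proof.
move=> gC; exists (Num.max C (\big[Num.max/0]_(i < p ^ n0) vabs (g i))) => k.
have kp : (k %% p ^ n0 < p ^ n0)%N by rewrite ltn_mod expn_gt0 prime_gt0.
rewrite [k](divn_eq _ (p ^ n0)) addnC -[g _](subrK (g (k %% p ^ n0)%N)).
rewrite (le_trans (vabsD _ _))// ge_max; apply/andP; split; rewrite le_max.
  by rewrite gC ?dvdn_mull.
apply/orP; right.
exact: (le_bigmax _ (fun i : 'I_(p ^ n0) => vabs (g i)) (Ordinal kp)).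
Qed.

End VolkenbornMean.

(** * Taylor expansion of y (log y - 1) *)

Section LogTaylor.
Context {R : realType} {K : ultrametricFieldType R} {p : nat} (log : K -> K).
Hypothesis log_Iwasawa : is_Iwasawa_log p log.
Hypothesis vabs_natS_ge : forall n, n.+1%:R^-1 <= vabs (n.+1%:R : K).
Implicit Types (x y z h u v w : K).

Lemma natS_neq0 n : n.+1%:R != 0 :> K.
Proof.
by rewrite -vabs_eq0 gt_eqF// (lt_le_trans _ (vabs_natS_ge n))// invr_gt0.
Qed.

Lemma natS_le_exp2 n : n.+1%:R <= 2 ^+ n.+1 :> R.
Proof. by rewrite -natrX ler_nat ltnW// ltn_expl. Qed.

(** A crude exponential bound suffices: it lets the denominators of the logarithm series be absorbed
    into a geometric ratio. *)
Lemma vabs_natSV_le n : vabs (n.+1%:R^-1 : K) <= 2 ^+ n.+1.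
Proof.
rewrite vabsV (le_trans _ (natS_le_exp2 n))// -[leRHS]invrK.
rewrite lef_pV2 ?posrE ?invr_gt0//.
by rewrite (lt_le_trans _ (vabs_natS_ge n))// invr_gt0.
Qed.

Lemma vabs_sign n : vabs ((-1) ^+ n : K) = 1.
Proof. by rewrite vabsX vabsN vabs1 expr1n. Qed.

Definition log1p_term u n : K := (-1) ^+ n * u ^+ n.+1 / n.+1%:R.

Lemma log1p_term_le u n : vabs (log1p_term u n) <= (2 * vabs u) ^+ n.+1.
Proof.
rewrite !vabsM vabs_sign mul1r vabsX exprMn mulrC.
by rewrite ler_wpM2r ?exprn_ge0 ?vabs_ge0// vabs_natSV_le.
Qed.

Lemma vabsV_le1 x : 1 <= vabs x -> vabs x^-1 <= 1.
Proof. by move=> x1; rewrite vabsV invf_le1// (lt_le_trans _ x1). Qed.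

Section Center.
Context (y : K).
Hypothesis y_ge1 : 1 <= vabs y.

Let y_neq0 : y != 0.
Proof. by rewrite -vabs_eq0 gt_eqF// (lt_le_trans _ y_ge1). Qed.

Lemma vabs_div_le h : vabs (h / y) <= vabs h.
Proof. by rewrite vabsM ler_piMr ?vabs_ge0// vabsV_le1. Qed.

Lemma vabs_addl_ge1 h : vabs h < 1 -> 1 <= vabs (y + h).
Proof. by move=> h1; rewrite vabs_addl_gt// (lt_le_trans h1). Qed.

(** Since [y + h = y * (1 + h / y)], the functional equation carries the expansion at [1] over to
    [y]. *)
Lemma log1p_cvg h : vabs h < 1 ->
  series (log1p_term (h / y)) @ \oo --> log (y + h) - log y.
Proof.
move=> h1; have u1 : vabs (h / y) < 1 by rewrite (le_lt_trans (vabs_div_le h)).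
have n0 : 1 + h / y != 0.
  by rewrite -vabs_eq0 vabs_addl_gt vabs1// oner_neq0.
have -> : log (y + h) - log y = log (1 + h / y).
  rewrite (_ : y + h = y * (1 + h / y)); last by field.
  by rewrite (Iwasawa_logM log_Iwasawa)// addrAC subrr add0r.
have := Iwasawa_log_series log_Iwasawa (x := 1 + h / y).
by rewrite addrAC subrr add0r; exact.
Qed.

(** This is [F^(m)(x) / m!] for [F(x) = x (log x - 1)], where [F' = log] and [F'' = 1/x]. *)
Definition taylor_coef m x : K := match m with
  | 0%N => x * (log x - 1)
  | 1%N => log x
  | s.+2 => (-1) ^+ s / s.+2%:R / s.+1%:R * x^-1 ^+ s.+1
  end.

(** With [l = log (y + h) - log y], the limit should be the first bracket plus [h * l + y * l]. The
    lengths [n] and [n.+1] make both truncations of [l] end in degree [n.+1] in [h]. *)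
Lemma taylor_series_partial h n :
  series (fun m => taylor_coef m y * h ^+ m) n.+2 =
  (y * (log y - 1) + log y * h - h) +
  (h * series (log1p_term (h / y)) n + y * series (log1p_term (h / y)) n.+1).
Proof.
elim: n => [|n IH].
  rewrite /series/= !big_nat_recr//= !big_geq// /log1p_term !expr0 !expr1.
  by field; rewrite y_neq0 oner_neq0.
rewrite /series/= in IH *; rewrite big_nat_recr//= IH.
rewrite [\sum_(0 <= k < n.+2) _]big_nat_recr//=.
rewrite [\sum_(0 <= k < n.+1) _]big_nat_recr//=.
rewrite /log1p_term.
move: (natS_neq0 n) (natS_neq0 n.+1); rewrite -[n.+2%:R]natr1.
rewrite !expr_div_n !exprVn !exprS; have := expf_neq0 n y_neq0.
move: (\sum_(0 <= _ < n) _) (n.+1%:R : K) (y ^+ n) (h ^+ n) ((-1) ^+ n : K).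
by move=> s a yn hn sgn yn0 a0 a10; field; rewrite a0 a10 yn0 y_neq0.
Qed.

Lemma taylor_series_cvg h : vabs h < 1 ->
  series (fun m => taylor_coef m y * h ^+ m) @ \oo -->
  (y + h) * (log (y + h) - 1).
Proof.
move=> h1; have L := log1p_cvg h1.
rewrite -(cvg_shiftn 2)/=.
under eq_fun do rewrite addn2 taylor_series_partial.
have -> : (y + h) * (log (y + h) - 1) = (y * (log y - 1) + log y * h - h) +
  (h * (log (y + h) - log y) + y * (log (y + h) - log y)) by ring.
apply: vabs_cvgD; first exact: cvg_cst.
apply: vabs_cvgD; apply: vabs_cvgMl => //.
by rewrite (cvg_shiftS (series (log1p_term (h / y)))).
Qed.

(** Each of the two denominators costs at most [2 ^+ s.+2]. *)
Lemma taylor_const_le s :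
  vabs ((-1) ^+ s / s.+2%:R / s.+1%:R : K) <= 4 ^+ s.+2.
Proof.
rewrite !vabsM vabs_sign mul1r.
rewrite (_ : 4 = 2 * 2); last by ring.
rewrite exprMn ler_pM ?vabs_ge0 ?vabs_natSV_le//.
by rewrite (le_trans (vabs_natSV_le _))// ler_weXn2l// ler1n.
Qed.

Lemma taylor_coef_ge2_le s : vabs (taylor_coef s.+2 y) <= 4 ^+ s.+2.
Proof.
rewrite /= vabsM -[leRHS]mulr1 ler_pM ?vabs_ge0 ?taylor_const_le//.
by rewrite vabsX exprn_ile1 ?vabs_ge0 ?vabsV_le1.
Qed.

(** * Estimates for increments of size at most 1/8 *)

Section Increment.
Context (h : K).
Hypothesis h_small : vabs h <= 8^-1.

Let h_lt1 : vabs h < 1.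
Proof. by rewrite (le_lt_trans h_small)// invf_lt1// ltr1n. Qed.

Let yh_ge1 : 1 <= vabs (y + h). Proof. exact: vabs_addl_ge1. Qed.

Let yh_neq0 : y + h != 0.
Proof. by rewrite -vabs_eq0 gt_eqF// (lt_le_trans _ yh_ge1). Qed.

(** As [2 * vabs h <= 1], the bounds on the terms decrease and the first governs the tail. *)
Let log1p_tail N n : (N <= n)%N ->
  vabs (log1p_term (h / y) n) <= (2 * vabs h) ^+ N.+1.
Proof.
move=> Nn; rewrite (le_trans (log1p_term_le _ _))//.
rewrite (@le_trans _ _ ((2 * vabs h) ^+ n.+1))//.
  rewrite lerXn2r ?nnegrE ?mulr_ge0 ?vabs_ge0// ler_wpM2l//.
  exact: vabs_div_le.
rewrite ler_wiXn2l// ?mulr_ge0 ?vabs_ge0//=; move: h_small; lra.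
Qed.

Lemma log_lipschitz : vabs (log (y + h) - log y) <= 2 * vabs h.
Proof.
rewrite -[X in vabs X]subr0 -[leRHS]expr1.
have := vabs_series_le (N := 0) _ (log1p_cvg h_lt1) (@log1p_tail 0).
by rewrite big_geq//; apply; rewrite expr1 mulr_ge0 ?vabs_ge0.
Qed.

Lemma log_taylor : vabs (log (y + h) - log y - h / y) <= 4 * vabs h ^+ 2.
Proof.
have := vabs_series_le (N := 1) _ (log1p_cvg h_lt1) (@log1p_tail 1).
rewrite big_nat1 /log1p_term expr0 mul1r expr1 divr1 exprMn -natrX.
by apply; rewrite mulr_ge0 ?exprn_ge0 ?vabs_ge0.
Qed.

Let inv_sub : (y + h)^-1 - y^-1 = - h * y^-1 * (y + h)^-1.
Proof. by field; rewrite yh_neq0 y_neq0. Qed.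

Let vabs_inv_sub : vabs ((y + h)^-1 - y^-1) <= vabs h.
Proof.
rewrite inv_sub vabsM vabsM vabsN -mulrA ler_piMr ?vabs_ge0//.
by rewrite mulr_ile1 ?vabs_ge0 ?vabsV_le1.
Qed.

Let vabs_invyh_le1 : vabs (y + h)^-1 <= 1.
Proof. exact: vabsV_le1. Qed.

Let vabs_nat_mul_le n x : vabs (n%:R * x) <= vabs x.
Proof. by rewrite vabsM ler_piMl ?vabs_ge0 ?vabs_nat. Qed.

Lemma exprV_lipschitz s : vabs ((y + h)^-1 ^+ s - y^-1 ^+ s) <= vabs h.
Proof.
elim: s => [|s IH]; first by rewrite subrr vabs0 vabs_ge0.
rewrite (_ : _ - _ = (y + h)^-1 * ((y + h)^-1 ^+ s - y^-1 ^+ s) +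
    ((y + h)^-1 - y^-1) * y^-1 ^+ s); last by rewrite !exprS; ring.
apply: vabs_le_add; rewrite vabsM.
  by rewrite (le_trans _ IH)// ler_piMl ?vabs_ge0.
rewrite (le_trans _ vabs_inv_sub)// ler_piMr ?vabs_ge0// vabsX.
by rewrite exprn_ile1 ?vabs_ge0 ?vabsV_le1.
Qed.

(** Induction from [1/(y+h) - 1/y + h/y^2 = h^2 / (y^2 (y+h))]. The constant is 1 because integers
    and both inverses have absolute value at most 1. *)
Lemma exprV_taylor s :
  vabs ((y + h)^-1 ^+ s.+1 - y^-1 ^+ s.+1 + s.+1%:R * y^-1 ^+ s.+2 * h)
    <= vabs h ^+ 2.
Proof.
set w := (y + h)^-1; set v := y^-1.
have vX_le1 n : vabs (v ^+ n) <= 1.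
  by rewrite vabsX exprn_ile1 ?vabs_ge0 ?vabsV_le1.
have h2_le x : vabs x <= 1 -> vabs (h ^+ 2 * x) <= vabs h ^+ 2.
  by move=> x1; rewrite vabsM vabsX ler_piMr ?exprn_ge0 ?vabs_ge0.
have wv : w - v = - h * v * w := inv_sub.
have base : w - v + h * v ^+ 2 = h ^+ 2 * (v ^+ 2 * w).
  rewrite wv (_ : _ + _ = - h * v * (w - v)); last by ring.
  by rewrite wv; ring.
elim: s => [|s IH].
  rewrite !expr1 mul1r (mulrC _ h) base h2_le// vabsM mulr_ile1 ?vabs_ge0//.
(* Multiply the expression for [s] by [w]; both correction terms are multiples of [h ^+ 2]. *)
rewrite (_ : _ + _ = w * (w ^+ s.+1 - v ^+ s.+1 + s.+1%:R * v ^+ s.+2 * h) +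
    ((w - v + h * v ^+ 2) * v ^+ s.+1 -
    s.+1%:R * (h * v ^+ s.+2) * (w - v))); last first.
  by rewrite -[s.+2%:R]natr1 !exprS; ring.
apply: vabs_le_add.
  by rewrite vabsM (le_trans _ IH)// ler_piMl ?vabs_ge0.
apply: vabs_le_sub.
  rewrite base -mulrA h2_le// -mulrA vabsM mulr_ile1 ?vabs_ge0//.
  by rewrite vabsM mulr_ile1 ?vabs_ge0.
rewrite wv (_ : _ * _ = h ^+ 2 * - (s.+1%:R * (v ^+ s.+3 * w))); last first.
  by rewrite !exprS; ring.
rewrite h2_le// vabsN (le_trans (vabs_nat_mul_le _ _))// vabsM.
by rewrite mulr_ile1 ?vabs_ge0.
Qed.

Lemma taylor_coef_ge2_lipschitz s :
  vabs (taylor_coef s.+2 (y + h) - taylor_coef s.+2 y) <= 4 ^+ s.+2 * vabs h.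
Proof.
rewrite /= -mulrBr vabsM ler_pM ?vabs_ge0 ?exprV_lipschitz//.
exact: taylor_const_le.
Qed.

(** The derivative of [taylor_coef m] is [m.+1%:R * taylor_coef m.+1]. The case [m = 0] is the
    Taylor tail from degree 2, [m = 1] is [log_taylor], and the rest are powers of the inverse. *)
Lemma taylor_coef_taylor m :
  vabs (taylor_coef m (y + h) - taylor_coef m y -
        m.+1%:R * taylor_coef m.+1 y * h) <= 16 * 4 ^+ m * vabs h ^+ 2.
Proof.
have h2 : 0 <= vabs h ^+ 2 by rewrite exprn_ge0 ?vabs_ge0.
case: m => [|[|s]].
(* This case fixes the constant [16 = 4 ^+ 2]: as [4 * vabs h <= 1], the degree-two bound dominates
   the higher ones. *)
- have h4 : 0 <= 4 * vabs h <= 1.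
    by rewrite mulr_ge0 ?vabs_ge0//=; move: h_small; lra.
  have -> : 16 * 4 ^+ 0 * vabs h ^+ 2 = (4 * vabs h) ^+ 2 by ring.
  have := vabs_series_le (N := 2) _ (taylor_series_cvg h_lt1).
  rewrite !big_nat_recr//= big_geq//.
  rewrite add0r expr0 expr1 !mulr1 mul1r opprD addrA; apply.
    by rewrite exprn_ge0 ?mulr_ge0 ?vabs_ge0.
  case=> [//|[//|s]] _; rewrite (@le_trans _ _ ((4 * vabs h) ^+ s.+2))//.
    rewrite vabsM vabsX exprMn ler_wpM2r ?exprn_ge0 ?vabs_ge0//.
    exact: taylor_coef_ge2_le.
  by case/andP: h4 => h0 h1; rewrite ler_wiXn2l.
- rewrite /= (_ : 2%:R * _ * h = h / y); last first.
    by field; rewrite y_neq0 oner_neq0 (natS_neq0 1).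
  rewrite (le_trans (log_taylor))// ler_wpM2r// expr1; lra.
- rewrite (_ : _ - _ = (-1) ^+ s / s.+2%:R / s.+1%:R *
    ((y + h)^-1 ^+ s.+1 - y^-1 ^+ s.+1 + s.+1%:R * y^-1 ^+ s.+2 * h)).
    rewrite vabsM ler_pM ?vabs_ge0 ?exprV_taylor//.
    rewrite (le_trans (taylor_const_le _))// ler_peMl ?exprn_ge0//; lra.
  rewrite /=; move: (natS_neq0 s) (natS_neq0 s.+1) (natS_neq0 s.+2).
  rewrite !exprS.
  move: (s.+1%:R : K) (s.+2%:R : K) (s.+3%:R : K) ((-1) ^+ s : K) => a b c e.
  move: ((y + h)^-1 ^+ s) (y^-1 ^+ s) => W V a0 b0 c0.
  by field; rewrite a0 b0 c0 y_neq0 yh_neq0.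
Qed.

End Increment.
End Center.
End LogTaylor.

(** * The Volkenborn sums of the log-gamma integrand *)

Section LogGammaMean.
Context {R : realType} {K : ultrametricFieldType R} {p : nat} (log : K -> K).
Hypothesis p_prime : prime p.
Hypothesis complete_K : is_complete K.
Hypothesis vabs_p : vabs (p%:R : K) = p%:R^-1.
Hypothesis vabs_natS_ge : forall n, n.+1%:R^-1 <= vabs (n.+1%:R : K).
Hypothesis log_Iwasawa : is_Iwasawa_log p log.
Implicit Types (x y z : K).

Definition integrand x (k : nat) : K :=
  if 1 <= vabs (x + k%:R) then (x + k%:R) * (log (x + k%:R) - 1) else 0.

Definition integrand_coef x m (k : nat) : K :=
  if 1 <= vabs (x + k%:R) then taylor_coef log m (x + k%:R) else 0.

Lemma vabs_addl_ge1E y z : vabs z < 1 -> (1 <= vabs (y + z)) = (1 <= vabs y).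
Proof.
move=> z1; apply/idP/idP => [yz|y1]; last exact: vabs_addl_ge1.
by rewrite -[y](addrK z); apply: vabs_addl_ge1 => //; rewrite vabsN.
Qed.

Lemma vabs_expn3_dvdn h : (p ^ 3 %| h)%N -> vabs (h%:R : K) <= 8^-1.
Proof.
case/dvdnP => i ->; rewrite (le_trans (vabs_muln_expn vabs_p _ _))//.
have p2 : (2 : R) <= p%:R by rewrite ler_nat prime_gt1.
have p_gt0 : (0 : R) < p%:R by rewrite (lt_le_trans _ p2).
rewrite lef_pV2 ?posrE ?exprn_gt0// (_ : 8 = 2 ^+ 3); last by ring.
by rewrite lerXn2r// nnegrE ltW.
Qed.

Lemma integrand_coef_shift x m k h : (p ^ 3 %| h)%N ->
  integrand_coef x m (k + h)%N = if 1 <= vabs (x + k%:R)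
    then taylor_coef log m (x + k%:R + h%:R) else 0.
Proof.
move=> /vabs_expn3_dvdn hs; have h1 : vabs (h%:R : K) < 1.
  by rewrite (le_lt_trans hs)// invf_lt1// ltr1n.
by rewrite /integrand_coef natrD addrA (vabs_addl_ge1E _ h1).
Qed.

Lemma integrand_coef_taylor x m k h : (p ^ 3 %| h)%N ->
  vabs (integrand_coef x m (k + h)%N - integrand_coef x m k -
    m.+1%:R * integrand_coef x m.+1 k * h%:R)
  <= 16 * 4 ^+ m * vabs (h%:R : K) ^+ 2.
Proof.
move=> ph; rewrite integrand_coef_shift// /integrand_coef.
case: ifPn => x1.
  exact: (taylor_coef_taylor log_Iwasawa vabs_natS_ge x1 (vabs_expn3_dvdn ph)).
by rewrite subrr mulr0 mul0r subrr vabs0 !mulr_ge0 ?exprn_ge0 ?vabs_ge0.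
Qed.

(** The sequence treated here is the derivative [g] that [mean_taylor_step] requires for
    [f = integrand_coef x m]. *)
Lemma integrand_coef_lipschitz x m k h : (p ^ 3 %| h)%N ->
  vabs (m.+1%:R * integrand_coef x m.+1 (k + h)%N -
    m.+1%:R * integrand_coef x m.+1 k) <= 16 * 4 ^+ m * vabs (h%:R : K).
Proof.
move=> ph; have hs := vabs_expn3_dvdn ph.
have h0 := vabs_ge0 (h%:R : K).
have X0 n : 0 <= 4 ^+ n :> R by rewrite exprn_ge0.
rewrite -mulrBr vabsM (le_trans (ler_piMl (vabs_ge0 _) (vabs_nat _ _)))//.
rewrite integrand_coef_shift// /integrand_coef.
case: ifPn => x1; last by rewrite subrr vabs0 !mulr_ge0.
case: m => [|s].
  rewrite (le_trans (log_lipschitz log_Iwasawa vabs_natS_ge x1 hs))//.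
  by rewrite expr0 mulr1 ler_wpM2r// ler_nat.
rewrite (le_trans (taylor_coef_ge2_lipschitz log vabs_natS_ge x1 hs s))//.
by rewrite ler_wpM2r// exprS ler_wpM2r// ler_nat.
Qed.

(** For [m = 0] the coefficient is [log], whose bound comes from finitely many residues and depends
    on [x]; the other coefficients have the explicit bound [4 ^+ m.+1]. *)
Lemma integrand_coef_bounded x : exists2 C, 16 <= C &
  forall m k, vabs (m.+1%:R * integrand_coef x m.+1 k) <= C * 4 ^+ m.
Proof.
have [k h ph|B gB] := @bounded_of_lipschitz R K p p_prime
    (fun k => 1%:R * integrand_coef x 1 k) 16 3.
  rewrite (le_trans (integrand_coef_lipschitz _ _ _ ph))// expr0 mulr1.
  by rewrite ler_piMr// vabs_nat.
exists (Num.max 16 B) => [|[|s] k]; first by rewrite le_max lexx.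
  by rewrite expr0 mulr1 le_max gB orbT.
rewrite vabsM (le_trans (ler_piMl (vabs_ge0 _) (vabs_nat _ _)))//.
have C16 : 16 <= Num.max 16 B by rewrite le_max lexx.
rewrite (@le_trans _ _ (4 ^+ s.+2))//; last first.
  by rewrite exprS ler_wpM2r ?exprn_ge0// (le_trans _ C16)// ler_nat.
rewrite /integrand_coef; case: ifPn => x1.
  exact: (taylor_coef_ge2_le log vabs_natS_ge x1).
by rewrite vabs0 exprn_ge0.
Qed.

Lemma integrand_coef_mean_step x : exists2 B : R, 0 <= B &
  forall m N, (3 <= N)%N ->
  vabs (mean p (integrand_coef x m) N.+1 -
        mean p (integrand_coef x m) N) <= B * 4 ^+ m * 2 ^- N.
Proof.
have [C C16 gC] := integrand_coef_bounded x.
have C0 : 0 <= C by rewrite (le_trans _ C16).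
have p0 n : 0 <= p%:R ^+ n :> R by rewrite exprn_ge0.
(* The exponent is [n0.+2] with [n0 = 3]. *)
exists (p%:R ^+ 5 * C) => [|m N N3]; first exact: mulr_ge0.
have X0 n : 0 <= 4 ^+ n :> R by rewrite exprn_ge0.
have Cm : 16 * 4 ^+ m <= C * 4 ^+ m by rewrite ler_wpM2r.
rewrite (le_trans (mean_taylor_step p_prime vabs_p (n0 := 3)
  (g := fun k => m.+1%:R * integrand_coef x m.+1 k) (C := C * 4 ^+ m)
  _ _ _ _ _))//.
- exact: mulr_ge0.
- move=> k h ph; rewrite (le_trans (integrand_coef_lipschitz _ _ _ ph))//.
  by rewrite ler_wpM2r ?vabs_ge0.
- move=> k h ph; rewrite (le_trans (integrand_coef_taylor _ _ _ ph))//.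
  by rewrite ler_wpM2r ?exprn_ge0 ?vabs_ge0.
have p2 : (2 : R) <= p%:R by rewrite ler_nat prime_gt1.
have p_gt0 : (0 : R) < p%:R by rewrite (lt_le_trans _ p2).
rewrite mulrA ler_wpM2l ?mulr_ge0// lef_pV2 ?posrE ?exprn_gt0//.
by rewrite lerXn2r// nnegrE ltW.
Qed.

(** For fixed [N] this is a finite combination of Taylor series at the points [x + j], with a cutoff
    unaffected by [z]. *)
Lemma integrand_mean_series x z N : vabs z < 1 ->
  series (fun m => mean p (integrand_coef x m) N * z ^+ m) @ \oo -->
  mean p (integrand (x + z)) N.
Proof.
move=> z1; rewrite /mean.
have -> : series (fun m => (p ^ N)%:R^-1 *
      (\sum_(0 <= j < p ^ N) integrand_coef x m j) * z ^+ m) =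
    fun n => (p ^ N)%:R^-1 * \sum_(0 <= j < p ^ N)
      series (fun m => integrand_coef x m j * z ^+ m) n.
  apply/funext => n; rewrite /series/= exchange_big/= mulr_sumr.
  by apply: eq_bigr => m _; rewrite -mulrA mulr_suml.
apply/vabs_cvgMl/vabs_cvg_sum => k.
rewrite /integrand /integrand_coef addrAC (vabs_addl_ge1E _ z1).
case: ifPn => x1; first exact: (taylor_series_cvg log_Iwasawa vabs_natS_ge x1).
rewrite (_ : series _ = cst 0); first exact: cvg_cst.
by apply/funext => n; rewrite /series/= big1// => m _; rewrite mul0r.
Qed.

Lemma integrand_mean_analytic x : exists c : nat -> K, forall z,
  vabs z < 8^-1 -> exists L : K,
    series (fun m => c m * z ^+ m) @ \oo --> L /\
    mean p (integrand (x + z)) @ \oo --> L.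
Proof.
have [B B0 stepB] := integrand_coef_mean_step x.
have /choice[c cP] m : exists l : K,
    mean p (integrand_coef x m) @ \oo --> l /\
    forall N, (3 <= N)%N ->
      vabs (l - mean p (integrand_coef x m) N) <= B * 4 ^+ m * 2 ^- N.
  apply: (geometric_half_cvg complete_K _ (stepB m)).
  by rewrite mulr_ge0 ?exprn_ge0.
exists c => z z8.
have z1 : vabs z < 1 by rewrite (lt_trans z8)// invf_lt1// ltr1n.
(* The terms [(c m - mean) * z ^+ m] are at most [B * 2 ^- N * (4 * vabs z) ^+ m], and
   [4 * vabs z < 1/2]; their sum [l] is therefore at most [B * 2 ^- N]. *)
have sumP N : (3 <= N)%N -> exists2 L : K,
    vabs (L - mean p (integrand (x + z)) N) <= B * 2 ^- N &
    series (fun m => c m * z ^+ m) @ \oo --> L.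
  move=> N3.
  have [m|l [dl lB]] := @geometric_half_series_cvg R K complete_K
      (fun m => (c m - mean p (integrand_coef x m) N) * z ^+ m)
      (B * 2 ^- N).
    rewrite vabsM (le_trans (ler_wpM2r _ ((cP m).2 N N3))) ?vabs_ge0//.
    rewrite (_ : _ * vabs _ = B * 2 ^- N * (4 ^+ m * vabs (z ^+ m)));
      last by ring.
    rewrite ler_wpM2l ?mulr_ge0 ?invr_ge0 ?exprn_ge0// vabsX -exprMn -exprVn.
    rewrite lerXn2r ?nnegrE ?mulr_ge0 ?vabs_ge0 ?invr_ge0//; move: z8; lra.
  exists (mean p (integrand (x + z)) N + l).
    by rewrite addrAC subrr add0r.
  have := vabs_cvgD (@integrand_mean_series x z N z1) dl.
  apply: cvg_trans; apply: near_eq_cvg; near=> n.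
  rewrite /series/= -big_split/=; apply: eq_bigr => m _.
  by rewrite mulrBl addrC subrK.
have [L _ cL] := sumP 3%N isT.
exists L; split => //.
apply/vabs_cvgP => e e0.
near=> N.
have N3 : (3 <= N)%N by near: N; exact: nbhs_infty_ge.
have [L' LB cL'] := sumP N N3.
(* The sum obtained from [sumP] does not depend on [N], so the error bounds for all [N] concern the
   same [L]. *)
rewrite (cvg_unique _ cL cL'); last exact: metric_hausdorff.
rewrite (le_lt_trans LB)//.
by near: N; exact: near_geometric_half_lt.
Unshelve. all: by end_near. Qed.

End LogGammaMean.

(** * Absolute values of integers in [Cp], and Volkenborn sums as means *)

Section PadicTower.
Context {R : realType} {p : nat} (T : padic_tower R p).

Lemma vabs_Cp_nat n : vabs (n%:R : Cp T) = padic_abs p n%:R.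
Proof.
rewrite -(rmorph_nat (Qpbar_Cp T)) vabs_Cp -(rmorph_nat (Qp_Qpbar T)).
by rewrite vabs_Qpbar -(vabs_rat T) ratr_nat.
Qed.

Lemma padic_abs_natS n : padic_abs p n.+1%:R = p%:R ^- logn p n.+1 :> R.
Proof.
rewrite /padic_abs pnatr_eq0/= (pmulrn (1 : rat)) numq_int denq_int logn1 sub0r.
by rewrite absz_nat exprnN.
Qed.

Lemma vabs_Cp_p : prime p -> vabs (p%:R : Cp T) = p%:R^-1.
Proof.
move=> p_prime; rewrite vabs_Cp_nat; have := padic_abs_natS p.-1.
by rewrite (prednK (prime_gt0 p_prime)) logn_prime// eqxx expr1.
Qed.

(** The [p]-part of [n.+1] divides it, hence is at most [n.+1]. *)
Lemma vabs_Cp_natS_ge n : n.+1%:R^-1 <= vabs (n.+1%:R : Cp T).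
Proof.
rewrite vabs_Cp_nat padic_abs_natS; have [p0|p0] := posnP p.
  (* For [p = 0] the default value [logn 0 _ = 0] makes the absolute value 1. *)
  by rewrite p0 lognE/= expr0 invr1 invf_le1// ler1n.
rewrite lef_pV2 ?posrE ?exprn_gt0 ?ltr0n// -natrX ler_nat.
by rewrite dvdn_leq// pfactor_dvdnn.
Qed.

Lemma Volkenborn_sum_LogGamma (log : Cp T -> Cp T) x :
  Volkenborn_sum (LogGamma_integrand log x) =
  mean p (integrand log x).
Proof.
apply/funext => N; rewrite /Volkenborn_sum /mean big_mkord.
congr (_ * _); apply: eq_bigr => k _.
rewrite /LogGamma_integrand /integrand /Zp_Cp/= !rmorph_nat /chi indicE.
case: ifPn => y1; first by rewrite mem_set// mulr1.
by rewrite memNset ?mulr0//; exact/negP.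
Qed.

End PadicTower.

Theorem mainTheorem2 (R : realType) (p : nat) (p_prime : prime p)
    (T : padic_tower R p) (log : Cp T -> Cp T)
    (log_Iwasawa : is_Iwasawa_log p log) :
  (forall x : Cp T, Volkenborn_integrable (LogGamma_integrand log x)) /\
  locally_analytic setT (LogGamma log).
Proof.
have analytic x := integrand_mean_analytic p_prime (@complete_Cp _ _ T)
  (vabs_Cp_p T p_prime) (vabs_Cp_natS_ge T) log_Iwasawa x.
split=> [x|a _].
  (* Existence of the integral at [x] is the case [z = 0] of the local expansion. *)
  have [c cP] := analytic x; have [|L [_ xL]] := cP 0.
    by rewrite vabs0 invr_gt0.
  by apply/cvg_ex; exists L; rewrite Volkenborn_sum_LogGamma -[x]addr0.
have [c cP] := analytic a; exists a, 8^-1, c; split => //.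
- by rewrite ballEmdist/= /vdist mdistxx.
- move=> x; rewrite ballEmdist/= /mdist/= vdist_sym => /cP[L [cL]].
  rewrite addrC subrK => xL.
  rewrite /LogGamma /Volkenborn_integral Volkenborn_sum_LogGamma.
  by rewrite (cvg_lim _ xL)//; exact: metric_hausdorff.
Qed.
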